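(* Let $b>1$ be an integer and let $H$ be a generalized $b$-happy function with digit mean $\mu$ and digit standard deviation $\sigma$. Let $C\subseteq\mathbb{N}$. Suppose $n_1$ is a positive integer satisfying bound (B), i.e. (B1) $4\left(1+3\mu+\sqrt{2}\,\sigma\, b^{5n_1/8}\right)\le b^{n_1-1}$, (B2) $\sqrt{3\mu b}\,\sigma\le b^{3n_1/8}$, (B3) $4\mu\left(3\mu+1+b^{3n_1/4}+2\sigma\mu^{-1/2}b^{5n_1/8}\right)\le b^{n_1-1}$, and suppose $I_1$ is an $n_1$-strict integer interval whose type-$C$ density equals $d_1$. Then the upper density of the set of type-$C$ integers satisfies $$\limsup_{N\to\infty}\frac{|\{i\in\mathbb{Z},\ 1\le i\le N:\ i \text{ is type-}C\}|}{N}\;\ge\; d_1\exp\!\left(-\frac{2}{b^{n_1/4}-1}-\frac{4\sigma}{\sqrt{\mu}\,\left(b^{n_1/8}-1\right)}\right).$$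
   Context: A generalized $b$-happy function: fix an integer $b>1$ and non-negative integers $h(0),h(1),\dots,h(b-1)$ with $h(0)=0$, $h(1)=1$. For a non-negative integer $n$ with base-$b$ expansion $n=\sum_{i=0}^k a_ib^i$ ($0\le a_i\le b-1$), set $H(n)=\sum_{i=0}^k h(a_i)$. The digit mean and digit variance of $H$ are the mean and variance of $h(X)$ for $X$ uniform on $\{0,1,\dots,b-1\}$: $\mu=\frac1b\sum_{j=0}^{b-1}h(j)$, $\sigma^2=\frac1b\sum_{j=0}^{b-1}(h(j)-\mu)^2$ (with $\sigma\ge 0$). For $C\subseteq\mathbb{N}$, an integer $n$ is type-$C$ if $H^k(n)\in C$ for some integer $k\ge 0$ ($H^k$ the $k$-th iterate). An integer interval $[a,c]$ ($a,c$ real) is the set of integers $x$ with $a\le x\le c$, and $|I|$ denotes its cardinality. The type-$C$ density of a finite nonempty integer interval $I$ is $|\{n\in I: n\text{ type-}C\}|/|I|$. For a positive integer $n$, an integer interval $I$ is $n$-strict if $I\subseteq[b^{n-1},b^n-1]$ and $|I|=b^{3n/4}$. *)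

(* Defs.v *)
From Stdlib Require Import Reals Lra Lia Arith ClassicalEpsilon.
From Coquelicot Require Import Coquelicot.
Open Scope R_scope.

(* Sum of h over the base-b digits of n, with a fuel argument
   (fuel n+1 suffices since n has at most n+1 base-b digits for b >= 2). *)
Fixpoint Hdig (fuel b : nat) (h : nat -> nat) (n : nat) : nat :=
  match fuel with
  | O => O
  | S f => (h (n mod b) + Hdig f b h (n / b))%nat
  end.

Definition Hfun (b : nat) (h : nat -> nat) (n : nat) : nat := Hdig (S n) b h n.

Definition digit_mean (b : nat) (h : nat -> nat) : R :=
  (/ INR b) * sum_f_R0 (fun j => INR (h j)) (b - 1).
Definition digit_var (b : nat) (h : nat -> nat) : R :=
  (/ INR b) * sum_f_R0 (fun j => (INR (h j) - digit_mean b h) ^ 2) (b - 1).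
Definition digit_sd (b : nat) (h : nat -> nat) : R := sqrt (digit_var b h).

Definition typeC (b : nat) (h : nat -> nat) (C : nat -> Prop) (n : nat) : Prop :=
  exists k : nat, C (Nat.iter k (Hfun b h) n).

Definition ind (P : Prop) : R :=
  if excluded_middle_informative P then 1 else 0.

Definition count_in (P : nat -> Prop) (lo hi : nat) : R :=
  sum_f_R0 (fun i => ind (P (lo + i)%nat)) (hi - lo).

Definition n_strict (b n lo hi : nat) : Prop :=
  (lo <= hi)%nat /\ (b ^ (n - 1) <= lo)%nat /\ (hi <= b ^ n - 1)%nat /\
  INR (hi - lo + 1) = Rpower (INR b) (3 * INR n / 4).

Definition typeC_density (b : nat) (h : nat -> nat) (C : nat -> Prop) (lo hi : nat) : R :=
  count_in (typeC b h C) lo hi / INR (hi - lo + 1).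

Definition typeC_ratio (b : nat) (h : nat -> nat) (C : nat -> Prop) (N : nat) : R :=
  (match N with O => 0 | S M => count_in (typeC b h C) 1 N end) / INR N.

(* Main.v *)
From Stdlib Require Import Reals Lra Lia Arith ClassicalEpsilon Classical.
From Coquelicot Require Import Coquelicot.
Require Import Defs.
Open Scope R_scope.

(** Write [E_m F] for the mean of [F (H Y)], with [Y] uniform on [0, b^m); then [H Y] is
    a sum of [m] independent copies of [h X], with mean [m mu] and variance [m sigma^2].

    From an [n]-strict interval [I] one gets a much longer one as follows.  Prefixing [Y]
    by a fixed block [t] of [k] digits shifts [H Y] by [s = H t], and every [s] in [1, k]
    occurs.  With [m = 3 k], chosen so that [m mu] is a little below [I], averaging over
    the shifts that carry the bulk of [H Y] through [I] yields one block of [b^m]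
    consecutive integers whose density is at least that of [I], up to a factor controlled by
    Chebyshev's inequality; the block is [4 k]-strict.  With [z = b^(n/8)] the factor is at
    least [exp (- (2 / z^2 + 4 sigma / (sqrt mu z)))], and since [n] at least doubles these
    losses telescope against [2 / (z^2 - 1) + 4 sigma / (sqrt mu (z - 1))].

    Strict intervals are too short to see the upper density, so the last step averages over
    the number of digits instead.  Let [g] be the indicator of the type-C elements of [I]
    and [G] its summatory function.  As [h 0 = 0] and [h 1 = 1], the law of [H Y] is almost
    invariant under translation by 1 when [m] is large, so [E_(m+1) G - E_m G] is close to
    [mu E_m g]; summing over the [m] for which the walk crosses [I] shows that some [m] has
    [E_m g] almost as large as the density of [I], and [E_m g] is at most the density of
    the type-C integers in [0, b^m). *)

(** * Elementary real inequalities and a criterion for the limit superior *)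

Lemma Rle_of_sq x y : 0 <= y -> x ^ 2 <= y ^ 2 -> x <= y.
Proof. intros; nra. Qed.

(** Pointwise form of Chebyshev's inequality: the parabola is at most [K] inside the window and
    nonpositive outside it, where [0 <= G] suffices. *)
Lemma quadratic_weight_ge K G x w :
  0 < w -> 0 <= K -> 0 <= G -> (- w <= x <= w -> K <= G) -> K * (1 - x ^ 2 / w ^ 2) <= G.
Proof.
  intros Hw HK HG H.
  assert (Hw2 : 0 < w ^ 2) by now apply pow_lt.
  destruct (Rle_dec (x ^ 2) (w ^ 2)) as [Hle|Hgt].
  - assert (0 <= x ^ 2 / w ^ 2) by (apply Rle_div_r; [lra | nra]).
    assert (- w <= x <= w) by (split; nra).
    specialize (H H1); nra.
  - assert (1 <= x ^ 2 / w ^ 2) by (apply Rle_div_r; lra). nra.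
Qed.

(** Upper-tail counterpart: [G] vanishes to the left of [w], and to the right of it the parabola
    already exceeds [K]. *)
Lemma quadratic_weight_le K G x w :
  0 < w -> 0 <= K -> G <= K -> (x < w -> G <= 0) -> G <= K * (x ^ 2 / w ^ 2).
Proof.
  intros Hw HK HG H.
  assert (Hw2 : 0 < w ^ 2) by now apply pow_lt.
  destruct (Rlt_le_dec x w) as [Hlt|Hle].
  - assert (0 <= x ^ 2 / w ^ 2) by (apply Rle_div_r; [lra | nra]).
    specialize (H Hlt); nra.
  - assert (1 <= x ^ 2 / w ^ 2) by (apply Rle_div_r; [lra | nra]). nra.
Qed.

(* [z = b^(n/8)], and [z^8 (1 + 1/beta) / (1 + 3 mu)] bounds the number [k] of prefixed digits:
   [w] is the half-width making Chebyshev's error [3 k sd^2 / w^2] at most [3 / (2 z^2)]. *)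
Lemma window_exists beta mu sd r z lo :
  2 <= beta -> 1 <= beta * mu -> 0 < sd -> 0 < r -> r ^ 2 = mu -> 0 < z ->
  4 * (1 + 3 * mu + sqrt 2 * sd * z ^ 5) <= z ^ 8 / beta ->
  4 * mu * (3 * mu + 1 + z ^ 6 + 2 * sd * / r * z ^ 5) <= z ^ 8 / beta ->
  z ^ 8 / beta <= lo ->
  exists w, 0 < w /\ w + 1 + 3 * mu <= z ^ 8 / beta /\
    3 * mu * (z ^ 6 + 1 + 3 * mu) + (1 + 6 * mu) * w < lo /\
    w ^ 2 * (1 + 3 * mu) = 2 * sd ^ 2 * z ^ 10 * (1 + / beta) /\
    w <= sd * z ^ 5 / r.
Proof.
  intros Hb Hbm Hsd Hr Hrm Hz B1 B3 Hlo.
  assert (Hz5 : 0 < z ^ 5) by now apply pow_lt.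
  assert (Hz6 : 0 < z ^ 6) by now apply pow_lt.
  set (y := sd * z ^ 5).
  assert (Hy : 0 < y) by (unfold y; nra).
  assert (Hs2 : 0 < sqrt 2) by (apply sqrt_lt_R0; lra).
  assert (Hs22 : sqrt 2 ^ 2 = 2) by (apply pow2_sqrt; lra).
  set (s := sqrt 2) in *.
  assert (Hmu : 0 < mu) by (rewrite <- Hrm; now apply pow_lt).
  replace (s * sd * z ^ 5) with (s * y) in B1 by (unfold y; ring).
  assert (E3 : 4 * mu * (3 * mu + 1 + z ^ 6 + 2 * sd * / r * z ^ 5)
    = 4 * mu * (3 * mu + 1 + z ^ 6) + 8 * r * y).
  { unfold y; rewrite <- Hrm; field; lra. }
  rewrite E3 in B3; clear E3.
  set (N := z ^ 8 / beta) in *.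
  set (ib := / beta).
  assert (Hib : 0 < ib) by (apply Rinv_0_lt_compat; lra).
  assert (Hib2 : ib <= 1 / 2).
  { unfold ib; apply Rle_trans with (/ 2); [apply Rinv_le_contravar; lra | lra]. }
  assert (Hibm : ib <= mu).
  { unfold ib; apply Rmult_le_reg_l with beta; [lra|]; rewrite Rinv_r; lra. }
  set (w := sqrt (2 * y ^ 2 * (1 + ib) / (1 + 3 * mu))).
  assert (Hpos : 0 < 2 * y ^ 2 * (1 + ib) / (1 + 3 * mu)).
  { apply Rdiv_lt_0_compat; [|lra].
    apply Rmult_lt_0_compat; [|lra]; apply Rmult_lt_0_compat; [lra | now apply pow_lt]. }
  assert (Hw : 0 < w) by now apply sqrt_lt_R0.
  assert (Hw2 : w ^ 2 * (1 + 3 * mu) = 2 * y ^ 2 * (1 + ib)).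
  { unfold w; rewrite pow2_sqrt by lra; field; lra. }
  assert (Hy2 : 0 < y ^ 2) by now apply pow_lt.
  assert (Hww : 0 < w ^ 2) by now apply pow_lt.
  exists w; split; [exact Hw|].
  (* From [ib <= 1 / 2] one has [w ^ 2 <= 3 * y ^ 2], and [(5 / 4) ^ 2 * 2 = 25 / 8] exceeds 3. *)
  assert (Ha : w <= 5 / 4 * (s * y)).
  { apply Rle_of_sq; [nra|].
    replace ((5 / 4 * (s * y)) ^ 2) with (25 / 16 * (s ^ 2) * y ^ 2) by field.
    rewrite Hs22; nra. }
  assert (Hb6 : (1 + 6 * mu) * w <= (6 * r + s) * y).
  { apply Rle_of_sq; [nra|].
    (* [36 * mu + 2] is [(6 * r + s) ^ 2] without its cross term [12 * r * s]. *)
    apply Rle_trans with ((36 * mu + 2) * y ^ 2).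
    - apply Rmult_le_reg_r with (1 + 3 * mu); [lra|].
      replace (((1 + 6 * mu) * w) ^ 2 * (1 + 3 * mu))
        with ((1 + 6 * mu) ^ 2 * (2 * (1 + ib)) * y ^ 2)
        by (rewrite <- (Rmult_1_r (((1 + 6 * mu) * w) ^ 2)) at 1;
            replace (((1 + 6 * mu) * w) ^ 2 * 1 * (1 + 3 * mu))
              with ((1 + 6 * mu) ^ 2 * (w ^ 2 * (1 + 3 * mu))) by ring;
            rewrite Hw2; ring).
      replace ((36 * mu + 2) * y ^ 2 * (1 + 3 * mu))
        with ((36 * mu + 2) * (1 + 3 * mu) * y ^ 2) by ring.
      apply Rmult_le_compat_r; [lra|].
      (* For small [mu] the bound [ib <= mu] is the efficient one, for large [mu] it is
         [ib <= 1 / 2]. *)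
      destruct (Rle_dec mu (1 / 2)) as [Hm|Hm].
      + apply Rle_trans with ((1 + 6 * mu) ^ 2 * (2 * (1 + mu))); [nra|].
        assert (mu ^ 3 <= mu * (1 / 4)) by nra. nra.
      + apply Rle_trans with ((1 + 6 * mu) ^ 2 * (2 * (1 + 1 / 2))); [nra|]. nra.
    - rewrite Rpow_mult_distr; apply Rmult_le_compat_r; [lra|].
      assert (0 < r * s) by nra. nra. }
  repeat split.
  - lra.
  (* Add three quarters of [B3] to one quarter of [B1]: the terms in [y] add up to
     [(6 * r + s) * y], which dominates [(1 + 6 * mu) * w]. *)
  - assert (0 < (1 + 3 * mu)) by lra. lra.
  - rewrite Hw2; unfold y; fold ib; ring.
  - apply Rle_of_sq; [apply Rlt_le, Rdiv_lt_0_compat; lra|].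
    replace ((y / r) ^ 2) with (y ^ 2 / mu) by (rewrite <- Hrm; field; lra).
    apply Rmult_le_reg_r with (mu); [lra|].
    replace (y ^ 2 / mu * mu) with (y ^ 2) by (field; lra).
    assert (y ^ 2 * ib <= y ^ 2 * (1 / 2)) by (apply Rmult_le_compat_l; lra).
    lra.
Qed.

(** With [x = / z ^ 2] this absorbs Chebyshev's error [3 / (2 z^2)] into an exponential. The proof
    writes [exp (2 x)] as a fourth power and uses [1 + x / 2 <= exp (x / 2)]; fewer equal factors
    would fail at [x = 1 / 4]. *)
Lemma exp_neg_le x : 0 <= x <= 1 / 4 -> exp (- (2 * x)) <= 1 - 3 / 2 * x.
Proof.
  intros Hx.
  replace (- (2 * x)) with (- (x / 2) + - (x / 2) + - (x / 2) + - (x / 2)) by lra.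
  rewrite !exp_plus, exp_Ropp.
  set (e := exp (x / 2)).
  assert (He : 1 + x / 2 <= e) by apply exp_ineq1_le.
  assert (He1 : / e <= / (1 + x / 2)) by (apply Rinv_le_contravar; lra).
  assert (He0 : 0 < / e) by (apply Rinv_0_lt_compat; lra).
  apply Rle_trans with (/ (1 + x / 2) * / (1 + x / 2) * / (1 + x / 2) * / (1 + x / 2)).
  - repeat apply Rmult_le_compat; try lra; repeat apply Rmult_le_pos; lra.
  - apply Rmult_le_reg_r with ((1 + x / 2) ^ 4); [apply pow_lt; lra|].
    replace (/ (1 + x / 2) * / (1 + x / 2) * / (1 + x / 2) * / (1 + x / 2) * (1 + x / 2) ^ 4)
      with 1 by (field; lra).
    (* This polynomial is [(1 - 3 / 2 * x) * (1 + x / 2) ^ 4 - 1]. *)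
    assert (0 <= x * (1/2 - x * (3/2) - x^2 * (7/4) - x^3 * (11/16) - x^4 * (3/32))); [|nra].
    apply Rmult_le_pos; [lra|].
    assert (x ^ 2 <= x / 4) by nra.
    assert (x ^ 3 <= x / 16) by nra. assert (x ^ 4 <= x / 64) by nra. lra.
Qed.

(** Since [/ (u - 1) - / u = / (u * (u - 1))] and [u * (u - 1) <= u ^ 2 - 1], squaring the variable
    pays for the term [/ u]. This is applied once to [z] and once to [z ^ 2]. *)
Lemma potential_step c z z' : 0 <= c -> 1 < z -> z ^ 2 <= z' ->
  2 / z ^ 2 + c / z + (2 / (z' ^ 2 - 1) + c / (z' - 1)) <= 2 / (z ^ 2 - 1) + c / (z - 1).
Proof.
  intros Hc Hz Hz'.
  assert (H : forall u v, 1 < u -> u ^ 2 <= v -> / u + / (v - 1) <= / (u - 1)).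
  { intros u v Hu Hv.
    apply Rle_trans with (/ u + / (u * (u - 1))).
    - apply Rplus_le_compat_l, Rinv_le_contravar; nra.
    - right; field; lra. }
  assert (H1 := H z z' Hz Hz').
  assert (Hz2 : 1 < z ^ 2) by nra.
  assert (H2 := H (z ^ 2) (z' ^ 2) Hz2 ltac:(nra)).
  unfold Rdiv; nra.
Qed.

Lemma LimSup_seq_ge (u : nat -> R) (l : R) :
  (forall eps N, 0 < eps -> exists n, (N <= n)%nat /\ l - eps <= u n) ->
  Rbar_le l (LimSup_seq u).
Proof.
  intros H; unfold LimSup_seq; destruct ex_LimSup_seq as [[x| |] Hx]; simpl in *; auto.
  - apply Rnot_lt_le; intros Hlt.
    assert (He : 0 < (l - x) / 2) by lra.
    destruct (Hx (mkposreal _ He)) as [_ [N HN]]; simpl in HN.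
    destruct (H _ N He) as (n & Hn & Hu); specialize (HN n Hn); lra.
  - destruct (Hx (l - 1)) as [N HN].
    destruct (H 1 N ltac:(lra)) as (n & Hn & Hu); specialize (HN n Hn); lra.
Qed.

(** * Finite sums over half-open ranges, and indicators *)

Fixpoint rsum (f : nat -> R) (n : nat) : R :=
  match n with O => 0 | S m => rsum f m + f m end.

(** [sum_f_R0] includes its upper end; the half-open form has an empty sum and concatenates without
    corrections. *)
Lemma rsum_sum_f_R0 f n : sum_f_R0 f n = rsum f (S n).
Proof.
  induction n as [|n IH]; simpl in *; [ring | rewrite IH; ring].
Qed.

Lemma rsum_ext f g n : (forall i, (i < n)%nat -> f i = g i) -> rsum f n = rsum g n.
Proof.
  induction n as [|n IH]; intros H; simpl; [reflexivity|].
  rewrite IH, H; auto.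
Qed.

Lemma rsum_le f g n : (forall i, (i < n)%nat -> f i <= g i) -> rsum f n <= rsum g n.
Proof.
  induction n as [|n IH]; intros H; simpl; [lra|].
  apply Rplus_le_compat; auto.
Qed.

Lemma rsum_plus f g n : rsum (fun i => f i + g i) n = rsum f n + rsum g n.
Proof. induction n as [|n IH]; simpl; [ring | rewrite IH; ring]. Qed.

Lemma rsum_scal c f n : rsum (fun i => c * f i) n = c * rsum f n.
Proof. induction n as [|n IH]; simpl; [ring | rewrite IH; ring]. Qed.

Lemma rsum_const c n : rsum (fun _ => c) n = INR n * c.
Proof. induction n as [|n IH]; [simpl; ring | rewrite S_INR; simpl; rewrite IH; ring]. Qed.

Lemma rsum_app f a n : rsum f (a + n) = rsum f a + rsum (fun i => f (a + i)%nat) n.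
Proof.
  induction n as [|n IH]; simpl; [rewrite Nat.add_0_r; ring|].
  rewrite Nat.add_succ_r; simpl; rewrite IH; ring.
Qed.

Lemma rsum_mul f n b :
  rsum f (n * b) = rsum (fun q => rsum (fun j => f (q * b + j)%nat) b) n.
Proof.
  induction n as [|n IH]; simpl; [reflexivity|].
  rewrite Nat.add_comm, rsum_app, IH; reflexivity.
Qed.

Lemma rsum_incr f a c : (forall i, 0 <= f i) -> (a <= c)%nat -> rsum f a <= rsum f c.
Proof.
  intros Hf Hac; replace c with (a + (c - a))%nat by lia; rewrite rsum_app.
  pose proof (rsum_le (fun _ => 0) (fun i => f (a + i)%nat) (c - a) (fun i _ => Hf _)) as H.
  rewrite rsum_const in H; lra.
Qed.

Lemma rsum_ge_exists f q V :
  (0 < q)%nat -> INR q * V <= rsum f q -> exists i, (i < q)%nat /\ V <= f i.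
Proof.
  intros Hq H; apply NNPP; intros Hn.
  assert (Hlt : forall i, (i < q)%nat -> f i < V).
  { intros i Hi; apply Rnot_le_lt; intros Hc; apply Hn; eauto. }
  assert (Hs : rsum f q < rsum (fun _ => V) q).
  { clear H Hn; destruct q as [|q]; [lia|]; simpl.
    apply Rplus_le_lt_compat; [|apply Hlt; lia].
    apply rsum_le; intros i Hi; left; apply Hlt; lia. }
  rewrite rsum_const in Hs; lra.
Qed.

Lemma ind_bounds P : 0 <= ind P <= 1.
Proof. unfold ind; destruct excluded_middle_informative; lra. Qed.

Lemma ind_le (P Q : Prop) : (P -> Q) -> ind P <= ind Q.
Proof. unfold ind; intros; do 2 destruct excluded_middle_informative; try lra; tauto. Qed.

Lemma count_in_rsum P lo hi :
  (lo <= hi)%nat ->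
  count_in P lo hi = rsum (fun i => ind (P i)) (S hi) - rsum (fun i => ind (P i)) lo.
Proof.
  intros H; unfold count_in; rewrite rsum_sum_f_R0.
  replace (S hi) with (lo + S (hi - lo))%nat by lia.
  rewrite rsum_app; ring.
Qed.

(** * Digit sums *)

Section Digits.
Variable b : nat.
Hypothesis hb : (1 < b)%nat.

Lemma b_pos : 0 < INR b.
Proof. apply lt_0_INR; lia. Qed.

(** Every power of b in the bounds is an integer power of this number, so the estimates become
    polynomial. *)
Definition root8 (n : nat) : R := Rpower (INR b) (INR n / 8).

Lemma root8_pow n k : root8 n ^ k = Rpower (INR b) (INR k * INR n / 8).
Proof.
  unfold root8; rewrite <- Rpower_pow by apply exp_pos.
  rewrite Rpower_mult; f_equal; field.
Qed.

Lemma root8_pow8 n : root8 n ^ 8 = INR b ^ n.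
Proof.
  rewrite root8_pow, <- Rpower_pow by apply b_pos.
  f_equal; simpl; field.
Qed.

Lemma root8_pred n : (0 < n)%nat -> INR b ^ (n - 1) = root8 n ^ 8 / INR b.
Proof.
  intros Hn; rewrite root8_pow8; replace n with (S (n - 1)) at 2 by lia.
  simpl; field; apply Rgt_not_eq, b_pos.
Qed.

Lemma root8_ge n : 1 + INR n / 16 <= root8 n.
Proof.
  unfold root8, Rpower; eapply Rle_trans; [|apply exp_ineq1_le].
  assert (/ 2 < ln (INR b)).
  { apply Rlt_le_trans with (ln 2); [apply ln_lt_2|].
    apply ln_le; [lra|]; change 2 with (INR 2); apply le_INR; lia. }
  pose proof (pos_INR n); nra.
Qed.

Lemma root8_double n n' : (2 * n <= n')%nat -> root8 n ^ 2 <= root8 n'.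
Proof.
  intros H; rewrite root8_pow; apply Rle_Rpower.
  - change 1 with (INR 1); apply le_INR; lia.
  - apply le_INR in H; rewrite mult_INR in H; simpl in *; lra.
Qed.

Variable h : nat -> nat.
Hypotheses (h0 : h 0%nat = 0%nat) (h1 : h 1%nat = 1%nat).

Lemma Hdig_zero f : Hdig f b h 0 = 0%nat.
Proof.
  induction f as [|f IH]; simpl; [reflexivity|].
  rewrite Nat.Div0.mod_0_l, Nat.Div0.div_0_l, h0, IH; reflexivity.
Qed.

(** Division by b decreases a positive n, and surplus fuel only reads zeros, which contribute
    [h 0 = 0]. *)
Lemma Hdig_fuel f1 : forall f2 n, (n <= f1)%nat -> (n <= f2)%nat -> Hdig f1 b h n = Hdig f2 b h n.
Proof.
  induction f1 as [|f1 IH]; intros f2 n H1 H2.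
  - replace n with 0%nat by lia; now rewrite !Hdig_zero.
  - destruct n as [|n]; [now rewrite !Hdig_zero|].
    destruct f2 as [|f2]; [lia|].
    assert (S n / b < S n)%nat by (apply Nat.div_lt; lia).
    change (h (S n mod b) + Hdig f1 b h (S n / b) = h (S n mod b) + Hdig f2 b h (S n / b))%nat.
    f_equal; apply IH; lia.
Qed.

Lemma Hfun_digit q j : (j < b)%nat -> Hfun b h (q * b + j) = (Hfun b h q + h j)%nat.
Proof.
  intros Hj; unfold Hfun at 1.
  change (h ((q * b + j) mod b) + Hdig (q * b + j) b h ((q * b + j) / b)
          = Hfun b h q + h j)%nat.
  replace ((q * b + j) mod b)%nat with j.
  2: rewrite Nat.add_comm, Nat.Div0.mod_add, Nat.mod_small; lia.
  replace ((q * b + j) / b)%nat with q.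
  2: rewrite Nat.div_add_l, Nat.div_small; lia.
  unfold Hfun; rewrite (Hdig_fuel (q * b + j) (S q)); nia.
Qed.

Lemma Hfun_0 : Hfun b h 0 = 0%nat.
Proof. apply Hdig_zero. Qed.

(** Digits concatenate; [y] may have leading zeros because [h 0 = 0]. *)
Lemma Hfun_shift t m : forall y, (y < b ^ m)%nat ->
  Hfun b h (t * b ^ m + y) = (Hfun b h t + Hfun b h y)%nat.
Proof.
  induction m as [|m IH]; intros y Hy.
  - simpl in Hy; replace y with 0%nat by lia.
    rewrite Hfun_0, Nat.pow_0_r, Nat.mul_1_r, !Nat.add_0_r; reflexivity.
  - simpl in Hy.
    pose proof (Nat.div_mod_eq y b) as E.
    pose proof (Nat.mod_upper_bound y b ltac:(lia)) as Hm.
    assert (Hq : (y / b < b ^ m)%nat) by (apply Nat.Div0.div_lt_upper_bound; lia).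
    revert E Hm Hq; generalize (y mod b)%nat as j, (y / b)%nat as q; intros j q E Hm Hq.
    replace y with (q * b + j)%nat by lia.
    replace (t * b ^ S m + (q * b + j))%nat with ((t * b ^ m + q) * b + j)%nat by (simpl; ring).
    rewrite !Hfun_digit, IH by lia; lia.
Qed.

(** Appending the digit 0 keeps the digit sum and appending 1 raises it by one, while the leading
    digit stays nonzero. The value 1 needs the digit 0, since [s - 1] would leave the range. *)
Lemma Hfun_onto k : forall s, (1 <= s <= k)%nat ->
  exists t, (b ^ (k - 1) <= t)%nat /\ (t < b ^ k)%nat /\ Hfun b h t = s.
Proof.
  induction k as [|k IH]; intros s Hs; [lia|].
  destruct (Nat.eq_dec k 0) as [->|Hk].
  - exists 1%nat; simpl; repeat split; try lia.
    change 1%nat with (0 * b + 1)%nat at 1; rewrite Hfun_digit, Hfun_0, h1; lia.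
  - assert (E : (b ^ (S k - 1) = b * b ^ (k - 1))%nat).
    { replace (S k - 1)%nat with (S (k - 1)) by lia; reflexivity. }
    rewrite E; change (b ^ S k)%nat with (b * b ^ k)%nat.
    destruct (Nat.eq_dec s 1) as [->|Hs1].
    + destruct (IH 1%nat) as (t & H1 & H2 & H3); [lia|].
      exists (t * b + 0)%nat; rewrite Hfun_digit, H3, h0 by lia.
      repeat split; nia.
    + destruct (IH (s - 1)%nat) as (t & H1 & H2 & H3); [lia|].
      exists (t * b + 1)%nat; rewrite Hfun_digit, H3, h1 by lia.
      repeat split; nia.
Qed.

(** * The digit-sum random walk *)

(** Transition operator of the walk whose step is [h X] with X a uniform digit. *)
Definition Pop (F : nat -> R) (x : nat) : R :=
  / INR b * rsum (fun j => F (x + h j)%nat) b.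

(* [Pit m F x] is the expectation of [F (x + H Y)] for [Y] uniform on [0, b^m). *)
Definition Pit (m : nat) (F : nat -> R) : nat -> R := Nat.iter m Pop F.

Lemma Pit_S m F x : Pit (S m) F x = Pop (Pit m F) x.
Proof. reflexivity. Qed.

Lemma Pop_ext F G x : (forall y, F y = G y) -> Pop F x = Pop G x.
Proof. intros H; unfold Pop; f_equal; apply rsum_ext; auto. Qed.

Lemma Pit_ext m F G : (forall y, F y = G y) -> forall x, Pit m F x = Pit m G x.
Proof.
  intros H; induction m as [|m IH]; intros x; [apply H|].
  rewrite !Pit_S; now apply Pop_ext.
Qed.

Lemma Pit_comm m F : forall x, Pit (S m) F x = Pit m (Pop F) x.
Proof.
  induction m as [|m IH]; intros x; [reflexivity|].
  rewrite Pit_S; rewrite (Pit_S m (Pop F)); apply Pop_ext, IH.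
Qed.

Lemma Pit_le m F G : (forall y, F y <= G y) -> forall x, Pit m F x <= Pit m G x.
Proof.
  intros H; induction m as [|m IH]; intros x; [apply H|].
  rewrite !Pit_S; apply Rmult_le_compat_l.
  - left; apply Rinv_0_lt_compat, b_pos.
  - apply rsum_le; auto.
Qed.

Lemma Pit_const m c x : Pit m (fun _ => c) x = c.
Proof.
  revert x; induction m as [|m IH]; intros x; [reflexivity|].
  rewrite Pit_S, (Pop_ext _ (fun _ => c)) by auto.
  unfold Pop; rewrite rsum_const; field; apply Rgt_not_eq, b_pos.
Qed.

Lemma Pit_lin m u F v G : forall x,
  Pit m (fun y => u * F y + v * G y) x = u * Pit m F x + v * Pit m G x.
Proof.
  induction m as [|m IH]; intros x; [reflexivity|].
  rewrite !Pit_S, (Pop_ext _ (fun y => u * Pit m F y + v * Pit m G y)) by auto.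
  unfold Pop; rewrite rsum_plus, !rsum_scal; ring.
Qed.

Lemma Pit_bounds m F : (forall y, 0 <= F y <= 1) -> forall x, 0 <= Pit m F x <= 1.
Proof.
  intros H x; split.
  - rewrite <- (Pit_const m 0 x); apply Pit_le; apply H.
  - rewrite <- (Pit_const m 1 x); apply Pit_le; apply H.
Qed.

Lemma Pit_shift m F a : forall x, Pit m (fun y => F (y + a)%nat) x = Pit m F (x + a)%nat.
Proof.
  induction m as [|m IH]; intros x; [reflexivity|].
  rewrite !Pit_S; unfold Pop; f_equal; apply rsum_ext; intros j _.
  rewrite IH; f_equal; lia.
Qed.

(** Turns a sum over consecutive shifts into the mean of the sum of [g] over a sliding window of
    length [q]. *)
Lemma Pit_rsum m g s0 q :
  rsum (fun i => Pit m g (s0 + i)%nat) q = Pit m (rsum g) (s0 + q)%nat - Pit m (rsum g) s0.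
Proof.
  induction q as [|q IH]; [rewrite Nat.add_0_r; simpl; ring|].
  simpl; rewrite IH.
  replace (s0 + S q)%nat with ((s0 + q) + 1)%nat by lia.
  rewrite <- (Pit_shift m (rsum g) 1).
  rewrite (Pit_ext m (fun y => rsum g (y + 1)%nat) (fun y => 1 * rsum g y + 1 * g y)).
  - rewrite Pit_lin; ring.
  - intros y; rewrite Nat.add_1_r; simpl; ring.
Qed.

(** Summing over the last digit replaces [F] by [Pop F], so the induction runs over all [F]. *)
Lemma sum_digits m F : forall x,
  rsum (fun y => F (x + Hfun b h y)%nat) (b ^ m) = INR (b ^ m) * Pit m F x.
Proof.
  revert F; induction m as [|m IH]; intros F x.
  - simpl (b ^ 0)%nat; simpl rsum; rewrite Hfun_0, Nat.add_0_r; simpl; ring.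
  - replace (b ^ S m)%nat with (b ^ m * b)%nat by (simpl; ring).
    rewrite rsum_mul, mult_INR, Pit_comm.
    rewrite (rsum_ext _ (fun q => INR b * Pop F (x + Hfun b h q)%nat)).
    + rewrite rsum_scal, (IH (Pop F)); ring.
    + intros q _; unfold Pop; rewrite <- Rmult_assoc, Rinv_r, Rmult_1_l
        by apply Rgt_not_eq, b_pos.
      apply rsum_ext; intros j Hj; rewrite Hfun_digit by exact Hj; f_equal; lia.
Qed.

Local Notation mu := (digit_mean b h).
Local Notation var := (digit_var b h).

Lemma sum_h : rsum (fun j => INR (h j)) b = INR b * mu.
Proof.
  unfold digit_mean; rewrite rsum_sum_f_R0; replace (S (b - 1)) with b by lia.
  field; apply Rgt_not_eq, b_pos.
Qed.

Lemma sum_h_var : rsum (fun j => (INR (h j) - mu) ^ 2) b = INR b * var.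
Proof.
  unfold digit_var; rewrite rsum_sum_f_R0; replace (S (b - 1)) with b by lia.
  field; apply Rgt_not_eq, b_pos.
Qed.

Lemma mean_ge : 1 <= INR b * mu.
Proof.
  rewrite <- sum_h.
  apply Rle_trans with (rsum (fun j => INR (h j)) 2).
  - simpl; rewrite h0, h1; simpl; lra.
  - apply rsum_incr; [intros; apply pos_INR | lia].
Qed.

Lemma mean_pos : 0 < mu.
Proof. pose proof mean_ge; pose proof b_pos; nra. Qed.

(** [h] is not constant: it takes the values 0 and 1. *)
Lemma var_pos : 0 < var.
Proof.
  assert (0 < INR b * var).
  { rewrite <- sum_h_var.
    apply Rlt_le_trans with (rsum (fun j => (INR (h j) - mu) ^ 2) 2).
    - simpl; rewrite h0, h1; simpl; nra.
    - apply rsum_incr; [intros; apply pow2_ge_0 | lia]. }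
  pose proof b_pos; nra.
Qed.

(** Squared bias plus variance: each digit moves the centre by [mu] and adds [var], its deviations
    from [mu] having mean zero. *)
Lemma Pit_square m c : forall x,
  Pit m (fun y => (INR y - c) ^ 2) x = (INR x + INR m * mu - c) ^ 2 + INR m * var.
Proof.
  induction m as [|m IH]; intros x; [simpl; ring|].
  rewrite Pit_S.
  rewrite (Pop_ext _ (fun y => (INR y + INR m * mu - c) ^ 2 + INR m * var)) by auto.
  unfold Pop; set (a := INR x + INR m * mu - c).
  rewrite (rsum_ext _ (fun j => (INR (h j) - mu) ^ 2
      + ((2 * (a + mu)) * INR (h j) + (a ^ 2 - mu ^ 2 + INR m * var)))).
  - rewrite rsum_plus, (rsum_plus (fun j => 2 * (a + mu) * INR (h j))).
    rewrite rsum_scal, rsum_const, sum_h, sum_h_var, S_INR.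
    unfold a; field; apply Rgt_not_eq, b_pos.
  - intros j _; unfold a; rewrite plus_INR; ring.
Qed.

(* Chebyshev's inequality, with the indicator of the bad event replaced by the
   quadratic that dominates it. *)
Lemma chebyshev_ge m F K w :
  0 < w -> (forall y, K * (1 - (INR y - INR m * mu) ^ 2 / w ^ 2) <= F y) ->
  K * (1 - INR m * var / w ^ 2) <= Pit m F 0.
Proof.
  intros Hw HF.
  apply Rle_trans with
    (Pit m (fun y => K * 1 + (- K / w ^ 2) * (INR y - INR m * mu) ^ 2) 0).
  - rewrite (Pit_lin m K (fun _ => 1)), Pit_const, Pit_square.
    right; rewrite INR_0; field; lra.
  - apply Pit_le; intros y; eapply Rle_trans; [|apply HF]; right; field; lra.
Qed.

Lemma chebyshev_le m F K w :
  0 < w -> (forall y, F y <= K * ((INR y - INR m * mu) ^ 2 / w ^ 2)) ->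
  Pit m F 0 <= K * (INR m * var / w ^ 2).
Proof.
  intros Hw HF.
  apply Rle_trans with
    (Pit m (fun y => 0 * 1 + (K / w ^ 2) * (INR y - INR m * mu) ^ 2) 0).
  - apply Pit_le; intros y; eapply Rle_trans; [apply HF|]; right; field; lra.
  - rewrite (Pit_lin m 0 (fun _ => 1)), Pit_square.
    right; rewrite INR_0; field; lra.
Qed.

(** * Smoothing *)

(** The defects [D j] are nonnegative with mean at most [e], so each is at most [b * e]. The digits
    0 and 1 make steps of length 0 and 1, which gives the sites [s] and [S s]. *)
Lemma Pop_diff_back (f : nat -> R) c e s :
  (forall x, f (S x) - f x <= c) -> c - e <= Pop f (S s) - Pop f s ->
  c - INR b * e <= f (S s) - f s /\ c - INR b * e <= f (S (S s)) - f (S s).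
Proof.
  intros Hc He.
  set (D := fun j => c - (f (S (s + h j)) - f (s + h j)%nat)).
  assert (HD : forall j, 0 <= D j) by (intros j; unfold D; specialize (Hc (s + h j)%nat); lra).
  assert (Hs : rsum D b <= INR b * e).
  { pose proof b_pos.
    assert (E : Pop f (S s) - Pop f s = / INR b * rsum (fun j => c + -1 * D j) b).
    { unfold Pop.
      rewrite (rsum_ext (fun j => c + -1 * D j)
        (fun j => f (S s + h j)%nat + -1 * f (s + h j)%nat)).
      - rewrite rsum_plus, rsum_scal; ring.
      - intros j _; unfold D; simpl; ring. }
    rewrite E, rsum_plus, rsum_const, rsum_scal in He.
    apply (Rmult_le_compat_l (INR b)) in He; [|lra].
    rewrite <- Rmult_assoc, Rinv_r in He; lra. }
  assert (H2 : rsum D 2 <= INR b * e).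
  { eapply Rle_trans; [apply rsum_incr; [exact HD | apply hb] | exact Hs]. }
  pose proof (HD 0%nat) as A0; pose proof (HD 1%nat) as A1.
  simpl in H2; unfold D in H2, A0, A1.
  rewrite h0, h1, Nat.add_0_r, Nat.add_1_r in H2.
  rewrite h0, Nat.add_0_r in A0; rewrite h1, Nat.add_1_r in A1; split; lra.
Qed.

(** Undoing one averaging multiplies the defect by b and passes from a site to itself and its
    successor, so J undoings reach [J + 1] consecutive sites. *)
Lemma Pit_diff_back (f : nat -> R) c : (forall x, f (S x) - f x <= c) ->
  forall J e s, c - e <= Pit J f (S s) - Pit J f s ->
  forall i, (i <= J)%nat -> c - INR b ^ J * e <= f (S (s + i)) - f (s + i)%nat.
Proof.
  intros Hc J; induction J as [|J IH]; intros e s He i Hi.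
  - replace i with 0%nat by lia; simpl in *; rewrite Nat.add_0_r; lra.
  - assert (HJ : forall x, Pit J f (S x) - Pit J f x <= c).
    { intros x.
      assert (H : Pit J (fun y => f (y + 1)%nat) x <= Pit J (fun y => 1 * f y + 1 * c) x).
      { apply Pit_le; intros y; rewrite Nat.add_1_r; specialize (Hc y); lra. }
      rewrite Pit_shift, (Pit_lin J 1 f 1 (fun _ => c)), Pit_const, Nat.add_1_r in H; lra. }
    destruct (Pop_diff_back (Pit J f) c e s HJ He) as [A B].
    replace (INR b ^ S J * e) with (INR b ^ J * (INR b * e)) by (simpl; ring).
    destruct (Nat.eq_dec i (S J)) as [->|Hne].
    + replace (s + S J)%nat with (S s + J)%nat by lia.
      exact (IH _ _ B J (le_n J)).
    + apply (IH _ _ A); lia.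
Qed.

(* If some increment of [Pit J f] is within [e] of the bound [c], then so are, up to a
   factor [b^J], the [J+1] consecutive increments of [f] from there on, and their sum
   exceeds the oscillation of [f]. *)
Lemma Pit_diff_improve J (f : nat -> R) c e :
  (forall y, 0 <= f y <= 1) -> (forall x, f (S x) - f x <= c) ->
  1 < INR (S J) * (c - INR b ^ J * e) ->
  forall s, Pit J f (S s) - Pit J f s <= c - e.
Proof.
  intros Hf Hc HJ s; apply Rnot_lt_le; intros Hlt.
  pose proof (Pit_diff_back f c Hc J e s (Rlt_le _ _ Hlt)) as Hb.
  assert (H : forall k, (k <= S J)%nat ->
     INR k * (c - INR b ^ J * e) <= f (s + k)%nat - f s).
  { induction k as [|k IH]; intros Hk; [rewrite Nat.add_0_r; simpl; lra|].
    specialize (Hb k ltac:(lia)); specialize (IH ltac:(lia)).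
    rewrite S_INR, Nat.add_succ_r; lra. }
  specialize (H (S J) (le_n _)).
  pose proof (Hf (s + S J)%nat); pose proof (Hf s); lra.
Qed.

Lemma Pit_add m k F x : Pit (m + k) F x = Pit m (Pit k F) x.
Proof. unfold Pit; now rewrite Nat.iter_add. Qed.

(** Increments start at most 1, and each block of [J] averagings lowers the bound by a fixed [e]
    until it reaches [eta]. The threshold [m0] does not depend on [f], which matters because [f]
    later varies with the interval. *)
Lemma Pit_smooth eta : 0 < eta -> exists m0, forall m f, (m0 <= m)%nat ->
  (forall y, 0 <= f y <= 1) -> forall s, Pit m f (S s) - Pit m f s <= eta.
Proof.
  intros He.
  destruct (nfloor_ex (2 / eta)) as [J HJ]; [apply Rlt_le, Rdiv_lt_0_compat; lra|].
  assert (HJ' : 2 < INR (S J) * eta).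
  { rewrite S_INR; destruct HJ as [_ HJ].
    apply (Rmult_lt_compat_r eta) in HJ; [|lra].
    unfold Rdiv in HJ; rewrite Rmult_assoc, Rinv_l in HJ; lra. }
  assert (HbJ : 0 < INR b ^ J) by apply pow_lt, b_pos.
  (* With this [e] and [eta <= c], the quantity [INR (S J) * (c - INR b ^ J * e)] is at least
     [INR (S J) * eta / 2], which exceeds 1. *)
  set (e := eta / 2 / INR b ^ J).
  assert (Hee : INR b ^ J * e = eta / 2) by (unfold e; field; lra).
  assert (He0 : 0 < e) by (unfold e; apply Rdiv_lt_0_compat; lra).
  assert (Hit : forall i f, (forall y, 0 <= f y <= 1) -> forall s,
      Pit (i * J) f (S s) - Pit (i * J) f s <= Rmax eta (1 - INR i * e)).
  { intros i f Hf; induction i as [|i IH]; intros s.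
    - eapply Rle_trans; [|apply Rmax_r]; simpl; pose proof (Hf s); pose proof (Hf (S s)); lra.
    - simpl (S i * J)%nat; rewrite !Pit_add.
      set (g := Pit (i * J) f) in *.
      assert (Hg : forall y, 0 <= g y <= 1) by (apply Pit_bounds, Hf).
      set (c := Rmax eta (1 - INR i * e)) in *.
      assert (Hce : eta <= c) by apply Rmax_l.
      apply Rle_trans with (c - e).
      + apply Pit_diff_improve; auto.
        rewrite Hee; pose proof (pos_INR (S J)); nra.
      + unfold c, Rmax; rewrite S_INR; do 2 destruct Rle_dec; lra. }
  destruct (nfloor_ex (1 / e)) as [i [_ Hi]]; [apply Rlt_le, Rdiv_lt_0_compat; lra|].
  exists (S i * J)%nat; intros m f Hm Hf s.
  replace m with (S i * J + (m - S i * J))%nat by lia; rewrite !Pit_add.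
  set (g := Pit (m - S i * J) f).
  eapply Rle_trans; [apply Hit; apply Pit_bounds, Hf|].
  apply Rmax_lub; [lra|].
  apply (Rmult_lt_compat_r e) in Hi; [|lra].
  unfold Rdiv in Hi; rewrite Rmult_assoc, Rinv_l in Hi; rewrite ?S_INR; lra.
Qed.

(** * Type-C counts *)

Variable C : nat -> Prop.
Local Notation sd := (digit_sd b h).
Local Notation TC := (fun i => ind (typeC b h C i)).

Lemma typeC_Hfun n : typeC b h C (Hfun b h n) -> typeC b h C n.
Proof. intros [k Hk]; exists (S k); now rewrite Nat.iter_succ_r. Qed.

Lemma TC_nonneg i : 0 <= TC i.
Proof. apply ind_bounds. Qed.

(** An integer whose image under H is type-C is itself type-C, and on this block H is [Hfun b h t]
    plus the walk. *)
Lemma count_block_ge t m :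
  INR (b ^ m) * Pit m TC (Hfun b h t) <= rsum TC (t * b ^ m + b ^ m) - rsum TC (t * b ^ m).
Proof.
  rewrite <- (sum_digits m TC), rsum_app.
  apply Rle_trans with (rsum (fun i => TC (t * b ^ m + i)%nat) (b ^ m)); [|lra].
  apply rsum_le; intros y Hy; apply ind_le; intros H.
  apply typeC_Hfun; now rewrite Hfun_shift.
Qed.

Lemma density_rsum lo hi : (lo <= hi)%nat ->
  typeC_density b h C lo hi * INR (hi - lo + 1) = rsum TC (S hi) - rsum TC lo.
Proof.
  intros H; unfold typeC_density; rewrite count_in_rsum by exact H.
  field; apply not_0_INR; lia.
Qed.

Lemma density_bounds lo hi : (lo <= hi)%nat -> 0 <= typeC_density b h C lo hi <= 1.
Proof.
  intros H; pose proof (density_rsum lo hi H) as E.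
  assert (0 < INR (hi - lo + 1)) by (apply lt_0_INR; lia).
  assert (0 <= rsum TC (S hi) - rsum TC lo <= INR (hi - lo + 1)).
  { replace (S hi) with (lo + (hi - lo + 1))%nat by lia; rewrite rsum_app.
    pose proof (rsum_le (fun _ => 0) (fun i => TC (lo + i)%nat) (hi - lo + 1)
       (fun i _ => TC_nonneg _)) as A.
    pose proof (rsum_le (fun i => TC (lo + i)%nat) (fun _ => 1) (hi - lo + 1)
       (fun i _ => proj2 (ind_bounds _))) as B.
    rewrite rsum_const in A, B; lra. }
  split; nra.
Qed.

Lemma density_block_ge t m : typeC_density b h C (t * b ^ m) (t * b ^ m + b ^ m - 1)
  >= Pit m TC (Hfun b h t).
Proof.
  assert (Hp : (0 < b ^ m)%nat) by (apply Nat.neq_0_lt_0, Nat.pow_nonzero; lia).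
  pose proof (count_block_ge t m) as H.
  pose proof (density_rsum (t * b ^ m) (t * b ^ m + b ^ m - 1) ltac:(lia)) as E.
  replace (S (t * b ^ m + b ^ m - 1)) with (t * b ^ m + b ^ m)%nat in E by lia.
  replace (t * b ^ m + b ^ m - 1 - t * b ^ m + 1)%nat with (b ^ m)%nat in E by lia.
  apply lt_0_INR in Hp; nra.
Qed.

(** Averages over the [q] shifts: their means add up to the mean count in a sliding window, which
    Chebyshev's inequality bounds below, so one shift does at least as well as the average. *)
Lemma exists_shift m s0 q K w :
  0 < w -> (0 < q)%nat ->
  (forall y, K * (1 - (INR y - INR m * digit_mean b h) ^ 2 / w ^ 2)
     <= rsum TC (y + (s0 + q)) - rsum TC (y + s0)) ->
  forall V, INR q * V <= K * (1 - INR m * digit_var b h / w ^ 2) ->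
  exists i, (i < q)%nat /\ V <= Pit m TC (s0 + i)%nat.
Proof.
  intros Hw Hq HF V HV.
  apply rsum_ge_exists with (f := fun i => Pit m TC (s0 + i)%nat); [exact Hq|].
  rewrite Pit_rsum.
  apply (Rle_trans _ _ _ HV).
  eapply Rle_trans; [apply chebyshev_ge; [exact Hw | exact HF]|].
  rewrite (Pit_ext _ _ (fun y => 1 * rsum TC (y + (s0 + q)) + (-1) * rsum TC (y + s0)))
    by (intros; ring).
  rewrite (Pit_lin m 1 (fun y => rsum TC (y + (s0 + q))) (-1) (fun y => rsum TC (y + s0))).
  rewrite !Pit_shift, !Nat.add_0_l; lra.
Qed.

(** * Passing to a longer strict interval *)

(** The bounds (B1) and (B3) in terms of [z = b^(n/8)], where [b^(n-1) = z^8 / b]. *)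
Definition bound_B (z : R) : Prop :=
  4 * (1 + 3 * mu + sqrt 2 * sd * z ^ 5) <= z ^ 8 / INR b /\
  4 * mu * (3 * mu + 1 + z ^ 6 + 2 * sd * / sqrt mu * z ^ 5) <= z ^ 8 / INR b.

Lemma sd_pos : 0 < sd.
Proof. apply sqrt_lt_R0, var_pos. Qed.

Lemma sd_sq : sd ^ 2 = var.
Proof. apply pow2_sqrt, Rlt_le, var_pos. Qed.

Lemma sqrt_mean_pos : 0 < sqrt mu.
Proof. apply sqrt_lt_R0, mean_pos. Qed.

(** Scaling z by [t >= 1] multiplies the right sides by [t ^ 8] and the left sides by at most that,
    their degree in z being at most 6. *)
Lemma bound_B_mono z z' : 0 < z -> z <= z' -> bound_B z -> bound_B z'.
Proof.
  intros Hz Hzz [B1 B3].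
  pose proof mean_pos; pose proof sd_pos; pose proof sqrt_mean_pos; pose proof b_pos.
  assert (0 < sqrt 2) by (apply sqrt_lt_R0; lra).
  set (t := z' / z).
  assert (Et : z' = z * t) by (unfold t; field; lra).
  assert (Ht : 1 <= t).
  { unfold t; apply Rmult_le_reg_r with z; [lra|]; unfold Rdiv.
    rewrite Rmult_assoc, Rinv_l; lra. }
  assert (T5 : t ^ 5 <= t ^ 8) by (apply Rle_pow; [lra | lia]).
  assert (T6 : t ^ 6 <= t ^ 8) by (apply Rle_pow; [lra | lia]).
  assert (T0 : 1 <= t ^ 8) by (apply pow_R1_Rle; lra).
  assert (Z5 : 0 < z ^ 5) by now apply pow_lt.
  assert (Z6 : 0 < z ^ 6) by now apply pow_lt.
  assert (P1 : 0 < sqrt 2 * sd * z ^ 5) by (repeat apply Rmult_lt_0_compat; lra).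
  assert (P2 : 0 < 2 * sd * / sqrt mu * z ^ 5).
  { repeat apply Rmult_lt_0_compat; try lra; now apply Rinv_0_lt_compat. }
  rewrite Et; split.
  - replace ((z * t) ^ 8 / INR b) with (t ^ 8 * (z ^ 8 / INR b)) by (field; lra).
    apply Rle_trans with (t ^ 8 * (4 * (1 + 3 * mu + sqrt 2 * sd * z ^ 5)));
      [|apply Rmult_le_compat_l; lra].
    rewrite Rpow_mult_distr.
    replace (sqrt 2 * sd * (z ^ 5 * t ^ 5)) with ((sqrt 2 * sd * z ^ 5) * t ^ 5) by ring.
    assert (sqrt 2 * sd * z ^ 5 * t ^ 5 <= sqrt 2 * sd * z ^ 5 * t ^ 8)
      by (apply Rmult_le_compat_l; lra).
    assert ((1 + 3 * mu) * 1 <= (1 + 3 * mu) * t ^ 8) by (apply Rmult_le_compat_l; lra).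
    lra.
  - replace ((z * t) ^ 8 / INR b) with (t ^ 8 * (z ^ 8 / INR b)) by (field; lra).
    apply Rle_trans with (t ^ 8 *
      (4 * mu * (3 * mu + 1 + z ^ 6 + 2 * sd * / sqrt mu * z ^ 5)));
      [|apply Rmult_le_compat_l; lra].
    rewrite !Rpow_mult_distr.
    replace (2 * sd * / sqrt mu * (z ^ 5 * t ^ 5))
      with ((2 * sd * / sqrt mu * z ^ 5) * t ^ 5) by ring.
    assert (A1 : 2 * sd * / sqrt mu * z ^ 5 * t ^ 5 <= 2 * sd * / sqrt mu * z ^ 5 * t ^ 8)
      by (apply Rmult_le_compat_l; lra).
    assert (A2 : (1 + 3 * mu) * 1 <= (1 + 3 * mu) * t ^ 8) by (apply Rmult_le_compat_l; lra).
    assert (A3 : z ^ 6 * t ^ 6 <= z ^ 6 * t ^ 8) by (apply Rmult_le_compat_l; lra).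
    replace (t ^ 8 * (4 * mu * (3 * mu + 1 + z ^ 6 + 2 * sd * / sqrt mu * z ^ 5)))
      with (4 * mu * ((1 + 3 * mu) * t ^ 8 + z ^ 6 * t ^ 8
        + 2 * sd * / sqrt mu * z ^ 5 * t ^ 8)) by ring.
    apply Rmult_le_compat_l; lra.
Qed.

(** (B3) contains [4 * mu * z ^ 6 <= z ^ 8 / b], and [1 <= b * mu]. *)
Lemma bound_B_ge2 z : 0 < z -> bound_B z -> 2 <= z.
Proof.
  intros Hz [_ B3].
  pose proof mean_pos; pose proof sd_pos; pose proof sqrt_mean_pos; pose proof b_pos.
  pose proof mean_ge as Hm.
  assert (Z5 : 0 < z ^ 5) by now apply pow_lt.
  assert (Z6 : 0 < z ^ 6) by now apply pow_lt.
  assert (P2 : 0 < 2 * sd * / sqrt mu * z ^ 5).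
  { repeat apply Rmult_lt_0_compat; try lra; now apply Rinv_0_lt_compat. }
  assert (A : 4 * mu * z ^ 6 <= z ^ 8 / INR b).
  { eapply Rle_trans; [|exact B3]; apply Rmult_le_compat_l; lra. }
  apply (Rmult_le_compat_l (INR b)) in A; [|lra].
  replace (INR b * (z ^ 8 / INR b)) with (z ^ 6 * z ^ 2) in A by (field; lra).
  assert (4 * z ^ 6 <= z ^ 6 * z ^ 2) by nra.
  assert (4 <= z ^ 2) by (apply Rmult_le_reg_l with (z ^ 6); lra).
  nra.
Qed.

Lemma strict_bounds n lo hi : (0 < n)%nat -> n_strict b n lo hi ->
  INR (hi - lo + 1) = root8 n ^ 6 /\ INR hi + 1 = INR lo + root8 n ^ 6 /\
  root8 n ^ 8 / INR b <= INR lo /\ INR hi + 1 <= root8 n ^ 8.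
Proof.
  intros Hn (H1 & H2 & H3 & H4).
  assert (E : INR (hi - lo + 1) = root8 n ^ 6).
  { rewrite H4, root8_pow; f_equal; simpl; field. }
  split; [exact E|]; split; [|split].
  - rewrite <- E, plus_INR, minus_INR by exact H1; simpl; ring.
  - rewrite <- root8_pred, <- pow_INR by exact Hn; now apply le_INR.
  - rewrite root8_pow8, <- pow_INR, <- S_INR; apply le_INR.
    assert (b ^ n <> 0)%nat by (apply Nat.pow_nonzero; lia); lia.
Qed.

(** When [y] is within [w] of the mean, the window from [y + s0] to [y + s0 + q] covers the
    interval; otherwise the left side is nonpositive. *)
Lemma window_contains m s0 q lo hi w y :
  0 < w -> (lo <= hi)%nat ->
  INR s0 < INR lo - INR m * mu - w + 1 ->
  INR hi - INR m * mu + w < INR (s0 + q) ->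
  (rsum TC (S hi) - rsum TC lo) * (1 - (INR y - INR m * mu) ^ 2 / w ^ 2)
     <= rsum TC (y + (s0 + q)) - rsum TC (y + s0).
Proof.
  intros Hw Hlh Hs0 Hs1.
  assert (HK : rsum TC lo <= rsum TC (S hi)) by (apply rsum_incr; [apply TC_nonneg | lia]).
  assert (HF : rsum TC (y + s0) <= rsum TC (y + (s0 + q))).
  { apply rsum_incr; [apply TC_nonneg | lia]. }
  apply quadratic_weight_ge; try lra; intros Hx.
  assert (A : rsum TC (S hi) <= rsum TC (y + (s0 + q))).
  { apply rsum_incr; [apply TC_nonneg|].
    apply INR_lt; rewrite plus_INR; lra. }
  assert (B : rsum TC (y + s0) <= rsum TC lo).
  { apply rsum_incr; [apply TC_nonneg|].
    apply Nat.lt_succ_r, INR_lt; rewrite plus_INR, S_INR; lra. }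
  lra.
Qed.

(** The first term pays for Chebyshev's error, the second for using more shifts than the interval
    has elements. *)
Definition loss (z : R) : R := 2 / z ^ 2 + 4 * sd / sqrt mu / z.

Lemma longer_interval n lo hi :
  (0 < n)%nat -> bound_B (root8 n) -> n_strict b n lo hi ->
  exists n' lo' hi', (2 * n <= n')%nat /\ n_strict b n' lo' hi' /\
    typeC_density b h C lo hi * exp (- loss (root8 n)) <= typeC_density b h C lo' hi'.
Proof.
  intros Hn HB Hst.
  pose proof (strict_bounds n lo hi Hn Hst) as (EL & Ehi & Hlo & Hhi).
  pose proof (proj1 Hst) as Hlh.
  pose proof (root8_ge n) as Hzn.
  pose proof (density_rsum lo hi Hlh) as Hd.
  pose proof (density_bounds lo hi Hlh) as Hd01.
  assert (Hn0 : 0 <= INR n) by apply pos_INR.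
  set (z := root8 n) in *.
  assert (Hz2 : 2 <= z) by (apply bound_B_ge2; [lra | exact HB]).
  pose proof mean_pos as Hmu; pose proof sd_pos as Hsd; pose proof sqrt_mean_pos as Hr.
  pose proof b_pos as Hb; pose proof mean_ge as Hbm.
  assert (Hr2 : sqrt mu ^ 2 = mu) by (apply pow2_sqrt; lra).
  assert (Hb2 : 2 <= INR b) by (change 2 with (INR 2); apply le_INR; lia).
  destruct HB as [B1 B3].
  destruct (window_exists (INR b) mu sd (sqrt mu) z (INR lo))
    as (w & Hw & Wa & Wb & Wc & We); auto; try lra.
  set (d := typeC_density b h C lo hi) in *.
  assert (Z6 : 64 <= z ^ 6).
  { replace 64 with (2 ^ 6) by ring; apply pow_incr; lra. }
  assert (Hz8 : 0 < z ^ 8) by (apply pow_lt; lra).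
  (* [k] is the least integer for which the largest shift, about [hi - 3 k mu + w], still fits below
     [k]. *)
  destruct (nfloor1_ex ((INR hi + 1 + w) / (1 + 3 * mu))) as [k0 Hk0].
  { apply Rdiv_lt_0_compat; [|lra]; pose proof (pos_INR hi); lra. }
  set (k := S k0).
  assert (Hk : INR hi + 1 + w <= INR k * (1 + 3 * mu)).
  { unfold k; rewrite S_INR; apply Rle_div_l; lra. }
  assert (Hk' : INR k * (1 + 3 * mu) < INR hi + 1 + w + (1 + 3 * mu)).
  { unfold k; rewrite S_INR; destruct Hk0 as [Hk0 _].
    apply Rlt_div_r in Hk0; lra. }
  clearbody k.
  (* The smallest shift is positive: multiply [Hk'] by [3 * mu] and use [Wb]. *)
  assert (Hc : 3 * mu * INR k + w < INR lo).
  { apply Rmult_lt_reg_r with (1 + 3 * mu); [lra|]. nra. }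
  assert (Hkz : z ^ 6 <= INR k).
  { apply Rmult_le_reg_r with (1 + 3 * mu); [lra|].
    assert (P2 : 0 < 2 * sd * / sqrt mu * z ^ 5).
    { repeat apply Rmult_lt_0_compat; try lra; try (apply pow_lt; lra).
      now apply Rinv_0_lt_compat. }
    assert (A : 4 * mu * z ^ 6 <= z ^ 8 / INR b).
    { eapply Rle_trans; [|exact B3]; apply Rmult_le_compat_l; lra. }
    nra. }
  assert (Hkn : (2 * n <= 4 * k)%nat).
  { apply INR_le; rewrite !mult_INR; simpl.
    assert (32 * z <= z ^ 6).
    { replace (z ^ 6) with (z ^ 5 * z) by ring.
      apply Rmult_le_compat_r; [lra|].
      replace 32 with (2 ^ 5) by ring; apply pow_incr; lra. }
    lra. }
  (* Three quarters of the [4 * k] digits stay free, which is the length required of a strict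
     interval. *)
  set (m := (3 * k)%nat).
  assert (Em : INR m = 3 * INR k) by (unfold m; rewrite mult_INR; simpl; ring).
  assert (Emu : INR m * mu = 3 * mu * INR k) by (rewrite Em; ring).
  (* The shifts run from the ceiling [s0] to the floor [N], both included, hence [q = S N - s0]. *)
  destruct (nfloor1_ex (INR lo - INR m * mu - w)) as [s00 Hs0]; [lra|].
  set (s0 := S s00).
  destruct (nfloor_ex (INR hi - INR m * mu + w)) as [N HN]; [lra|].
  assert (Hs0' : INR lo - INR m * mu - w <= INR s0 < INR lo - INR m * mu - w + 1)
    by (unfold s0; rewrite S_INR; lra).
  assert (HsN : (s0 < S N)%nat) by (apply INR_lt; rewrite S_INR; lra).
  assert (HNk : (S N <= k)%nat) by (apply INR_le; rewrite S_INR; lra).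
  set (q := (S N - s0)%nat).
  assert (Eq : (s0 + q = S N)%nat) by (unfold q; lia).
  assert (Hq : INR q <= z ^ 6 + 2 * w).
  { unfold q; rewrite minus_INR, S_INR by lia; lra. }
  assert (HV : INR q * (d * exp (- loss z))
     <= (rsum TC (S hi) - rsum TC lo) * (1 - INR m * var / w ^ 2)).
  { rewrite <- Hd, EL.
    set (c := 4 * sd / sqrt mu / z).
    assert (Hc0 : 0 < c) by (unfold c; repeat apply Rdiv_lt_0_compat; lra).
    assert (Hqc : INR q <= z ^ 6 * exp c).
    { apply Rle_trans with (z ^ 6 * (1 + c)).
      - replace (z ^ 6 * (1 + c)) with (z ^ 6 + 4 * (sd * z ^ 5 / sqrt mu))
          by (unfold c; field; lra).
        assert (0 < sd * z ^ 5 / sqrt mu); [|lra].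
        apply Rdiv_lt_0_compat; [|lra]; apply Rmult_lt_0_compat; [lra | apply pow_lt; lra].
      - apply Rmult_le_compat_l; [lra | apply exp_ineq1_le]. }
    assert (Hx : 0 <= / z ^ 2 <= 1 / 4).
    { split; [left; apply Rinv_0_lt_compat, pow_lt; lra|].
      replace (1 / 4) with (/ 2 ^ 2) by lra.
      apply Rinv_le_contravar; [lra | apply pow_incr; lra]. }
    (* [Hk'] and [Wa] give [k (1 + 3 mu) <= z^8 (1 + 1/b)], and [Wc] fixes [w ^ 2] to match. *)
    assert (Hcheb : INR m * var / w ^ 2 <= 3 / 2 * / z ^ 2).
    { assert (0 < w ^ 2) by now apply pow_lt.
      assert (0 < z ^ 2) by (apply pow_lt; lra).
      apply Rle_div_l; [lra|].
      apply Rmult_le_reg_r with (z ^ 2); [lra|].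
      replace (3 / 2 * / z ^ 2 * w ^ 2 * z ^ 2) with (3 / 2 * w ^ 2) by (field; lra).
      rewrite Em, <- sd_sq.
      apply Rmult_le_reg_r with (1 + 3 * mu); [lra|].
      replace (3 / 2 * w ^ 2 * (1 + 3 * mu)) with (3 / 2 * (w ^ 2 * (1 + 3 * mu))) by ring.
      rewrite Wc.
      replace (3 * INR k * sd ^ 2 * z ^ 2 * (1 + 3 * mu))
        with (3 * sd ^ 2 * z ^ 2 * (INR k * (1 + 3 * mu))) by ring.
      replace (3 / 2 * (2 * sd ^ 2 * z ^ 10 * (1 + / INR b)))
        with (3 * sd ^ 2 * z ^ 2 * (z ^ 8 + z ^ 8 / INR b)) by (field; lra).
      apply Rmult_le_compat_l; [|lra].
      repeat apply Rmult_le_pos; try lra; apply pow_le; lra. }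
    assert (He := exp_neg_le _ Hx).
    replace (- loss z) with (- (2 * / z ^ 2) + - c) by (unfold loss, c; field; lra).
    rewrite exp_plus.
    pose proof (exp_pos (- (2 * / z ^ 2))) as He1; pose proof (exp_pos (- c)) as He2.
    assert (Hee : exp c * exp (- c) = 1) by (rewrite <- exp_plus, Rplus_opp_r; apply exp_0).
    apply Rle_trans with (z ^ 6 * exp c * (d * (exp (- (2 * / z ^ 2)) * exp (- c)))).
    - apply Rmult_le_compat_r; [|exact Hqc].
      apply Rmult_le_pos; [lra|]; apply Rmult_le_pos; lra.
    - replace (z ^ 6 * exp c * (d * (exp (- (2 * / z ^ 2)) * exp (- c))))
        with (d * z ^ 6 * exp (- (2 * / z ^ 2)) * (exp c * exp (- c))) by ring.
      rewrite Hee, Rmult_1_r; apply Rmult_le_compat_l; [apply Rmult_le_pos; lra | lra]. }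
  destruct (exists_shift m s0 q (rsum TC (S hi) - rsum TC lo) w Hw ltac:(lia))
    with (V := d * exp (- loss z)) as (i & Hi & HVi).
  - intros y; apply window_contains; auto; [lra|]; rewrite Eq, S_INR; lra.
  - exact HV.
  - destruct (Hfun_onto k (s0 + i)) as (t & T1 & T2 & T3); [lia|].
    assert (Hp : (0 < b ^ m)%nat) by (apply Nat.neq_0_lt_0, Nat.pow_nonzero; lia).
    exists (4 * k)%nat, (t * b ^ m)%nat, (t * b ^ m + b ^ m - 1)%nat.
    split; [exact Hkn|]; split.
    + repeat split.
      * lia.
      * replace (4 * k - 1)%nat with (k - 1 + m)%nat by lia.
        rewrite Nat.pow_add_r; now apply Nat.mul_le_mono_r.
      * replace (4 * k)%nat with (k + m)%nat by lia.
        rewrite Nat.pow_add_r; nia.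
      * replace (t * b ^ m + b ^ m - 1 - t * b ^ m + 1)%nat with (b ^ m)%nat by lia.
        rewrite pow_INR, <- Rpower_pow by exact Hb.
        f_equal; rewrite Em, mult_INR; simpl; field.
    + pose proof (density_block_ge t m) as H; rewrite T3 in H; lra.
Qed.

Definition potential (z : R) : R := 2 / (z ^ 2 - 1) + 4 * sd / sqrt mu / (z - 1).

(** Density times [exp (- potential)] never decreases along the chain of intervals, by
    [potential_step]; at the end the exponential is bounded by 1. *)
Lemma strict_intervals_unbounded n lo hi :
  (0 < n)%nat -> bound_B (root8 n) -> n_strict b n lo hi ->
  forall N, exists n' lo' hi', (N <= n')%nat /\ (0 < n')%nat /\ n_strict b n' lo' hi' /\
    typeC_density b h C lo hi * exp (- potential (root8 n)) <= typeC_density b h C lo' hi'.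
Proof.
  intros Hn HB Hst.
  assert (Hpos : forall n, 0 < root8 n) by (intros; apply exp_pos).
  assert (Hc : 0 < 4 * sd / sqrt mu).
  { pose proof sd_pos; pose proof sqrt_mean_pos; apply Rdiv_lt_0_compat; lra. }
  assert (Hpot : forall z, 2 <= z -> 0 <= potential z).
  { intros z Hz; unfold potential.
    apply Rplus_le_le_0_compat; apply Rlt_le, Rdiv_lt_0_compat; nra. }
  assert (Hit : forall N, exists n' lo' hi', (N <= n')%nat /\ (0 < n')%nat /\
     bound_B (root8 n') /\ n_strict b n' lo' hi' /\
     typeC_density b h C lo hi * exp (- potential (root8 n))
       <= typeC_density b h C lo' hi' * exp (- potential (root8 n'))).
  { induction N as [|N IH].
    - exists n, lo, hi; repeat split; auto; try apply Hst; try apply HB; try lia; lra.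
    - destruct IH as (n1 & lo1 & hi1 & A1 & A2 & A3 & A4 & A5).
      destruct (longer_interval n1 lo1 hi1 A2 A3 A4) as (n2 & lo2 & hi2 & C1 & C2 & C3).
      exists n2, lo2, hi2; split; [lia|]; split; [lia|].
      assert (Z2 : 2 <= root8 n1) by (apply bound_B_ge2; auto).
      assert (Hzz := root8_double _ _ C1).
      split; [apply bound_B_mono with (root8 n1); auto; nra|].
      split; [exact C2|].
      apply (Rle_trans _ _ _ A5).
      apply Rle_trans with (typeC_density b h C lo1 hi1
        * exp (- loss (root8 n1)) * exp (- potential (root8 n2))).
      + rewrite Rmult_assoc, <- exp_plus.
        apply Rmult_le_compat_l; [apply density_bounds, A4|].
        assert (Hs := potential_step (4 * sd / sqrt mu) (root8 n1) (root8 n2)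
          ltac:(lra) ltac:(lra) Hzz).
        assert (Hle : - potential (root8 n1) <= - loss (root8 n1) + - potential (root8 n2))
          by (unfold potential, loss; lra).
        destruct Hle as [Hlt | ->]; [left; now apply exp_increasing | lra].
      + apply Rmult_le_compat_r; [left; apply exp_pos | exact C3]. }
  intros N; destruct (Hit N) as (n1 & lo1 & hi1 & A1 & A2 & A3 & A4 & A5).
  exists n1, lo1, hi1; repeat split; try apply A4; auto.
  apply (Rle_trans _ _ _ A5).
  rewrite <- Rmult_1_r; apply Rmult_le_compat_l; [apply density_bounds, A4|].
  rewrite <- exp_0.
  assert (Hle := Hpot _ (bound_B_ge2 _ (Hpos n1) A3)).
  destruct (Rle_lt_or_eq_dec _ _ Hle) as [Hlt | <-]; [left; apply exp_increasing; lra|].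
  rewrite Ropp_0; lra.
Qed.

(** * From strict intervals to upper density *)

(** The function g of the last step; its sums vanish up to [lo] and are constant beyond [hi]. *)
Definition TC_on (lo hi i : nat) : R := if (Nat.leb lo i && Nat.leb i hi)%bool then TC i else 0.

Lemma TC_on_bounds lo hi i : 0 <= TC_on lo hi i <= TC i.
Proof.
  unfold TC_on; pose proof (TC_nonneg i) as H; cbv beta in H.
  destruct (_ && _)%bool; lra.
Qed.

Lemma rsum_TC_on_low lo hi x : (x <= lo)%nat -> rsum (TC_on lo hi) x = 0.
Proof.
  intros Hx; rewrite (rsum_ext _ (fun _ => 0)); [rewrite rsum_const; ring|].
  intros i Hi; unfold TC_on.
  destruct (Nat.leb_spec lo i); [lia | reflexivity].
Qed.

Lemma rsum_TC_on_high lo hi x : (lo <= hi)%nat -> (S hi <= x)%nat ->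
  rsum (TC_on lo hi) x = rsum TC (S hi) - rsum TC lo.
Proof.
  intros Hlh Hx; replace x with (S hi + (x - S hi))%nat by lia; rewrite rsum_app.
  rewrite (rsum_ext (fun i => TC_on lo hi (S hi + i)) (fun _ => 0)).
  2: { intros i Hi; unfold TC_on.
       destruct (Nat.leb_spec lo (S hi + i)), (Nat.leb_spec (S hi + i) hi); simpl; lia || reflexivity. }
  replace (S hi) with (lo + (S hi - lo))%nat by lia.
  rewrite !rsum_app, rsum_const, rsum_TC_on_low by lia.
  rewrite (rsum_ext (fun i => TC_on lo hi (lo + i)) (fun i => TC (lo + i)%nat)).
  - ring.
  - intros i Hi; unfold TC_on.
    destruct (Nat.leb_spec lo (lo + i)), (Nat.leb_spec (lo + i) hi); simpl; lia || reflexivity.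
Qed.

Lemma rsum_TC_on_le lo hi x : (lo <= hi)%nat ->
  0 <= rsum (TC_on lo hi) x <= rsum TC (S hi) - rsum TC lo.
Proof.
  intros Hlh; split.
  - apply (rsum_incr (TC_on lo hi) 0 x); [apply TC_on_bounds | lia].
  - rewrite <- (rsum_TC_on_high lo hi (x + S hi)) by lia.
    apply rsum_incr; [apply TC_on_bounds | lia].
Qed.

Definition digit_square_mean : R := / INR b * rsum (fun j => INR (h j) ^ 2) b.

(* One more digit moves the walk by [h j], so the expected growth of [rsum g] is the
   expectation of [g] over the [h j] sites passed; smoothness replaces each by [g] at the
   current site. *)
Lemma Pit_rsum_drift m g eta :
  0 <= eta -> (forall s, Pit m g (S s) - Pit m g s <= eta) ->
  Pit (S m) (rsum g) 0 - Pit m (rsum g) 0 <= mu * Pit m g 0 + digit_square_mean * eta.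
Proof.
  intros He Hs; pose proof b_pos as Hb.
  assert (Hi : forall i, Pit m g i <= Pit m g 0 + INR i * eta).
  { induction i as [|i IH]; [simpl; lra|]; rewrite S_INR; specialize (Hs i); lra. }
  assert (Hj : forall a, Pit m (rsum g) a
      <= Pit m (rsum g) 0 + INR a * Pit m g 0 + eta * INR a ^ 2).
  { intros a; pose proof (Pit_rsum m g 0 a) as E; rewrite Nat.add_0_l in E.
    assert (H : rsum (fun i => Pit m g (0 + i)%nat) a <= rsum (fun _ => Pit m g 0 + INR a * eta) a).
    { apply rsum_le; intros i Hia; eapply Rle_trans; [apply Hi|].
      apply lt_INR in Hia; simpl; nra. }
    rewrite rsum_const in H; nra. }
  rewrite Pit_S; unfold Pop, digit_square_mean.
  apply Rle_trans with (/ INR b * rsum (fun j => (Pit m (rsum g) 0 + Pit m g 0 * INR (h j))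
      + eta * INR (h j) ^ 2) b - Pit m (rsum g) 0).
  - apply Rplus_le_compat_r, Rmult_le_compat_l; [left; now apply Rinv_0_lt_compat|].
    apply rsum_le; intros j _; rewrite Nat.add_0_l; specialize (Hj (h j)); lra.
  - rewrite (rsum_plus (fun j => Pit m (rsum g) 0 + Pit m g 0 * INR (h j))).
    rewrite (rsum_plus (fun _ => Pit m (rsum g) 0)).
    rewrite rsum_const, !rsum_scal, sum_h; right; field; lra.
Qed.

Lemma Pit_rsum_telescope m0 g eta q :
  0 <= eta -> (forall m, (m0 <= m)%nat -> forall s, Pit m g (S s) - Pit m g s <= eta) ->
  Pit (m0 + q) (rsum g) 0 - Pit m0 (rsum g) 0
    <= rsum (fun i => mu * Pit (m0 + i) g 0 + digit_square_mean * eta) q.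
Proof.
  intros He Hs; induction q as [|q IH].
  - rewrite Nat.add_0_r; simpl; lra.
  - assert (H := Pit_rsum_drift (m0 + q) g eta He (Hs _ (Nat.le_add_r _ _))).
    rewrite Nat.add_succ_r; simpl rsum; lra.
Qed.

(** The mean of [rsum g] climbs from almost 0 at [m0] to almost [K] at [M], in about [z^6 / mu]
    steps, so some step has drift close to [mu * d]. *)
Lemma Pit_mass_ge eps N0 : 0 < eps ->
  exists n0, forall n lo hi, (n0 <= n)%nat -> (0 < n)%nat -> n_strict b n lo hi ->
  exists m, (N0 <= m)%nat /\ typeC_density b h C lo hi - eps <= Pit m TC 0.
Proof.
  intros Heps.
  pose proof mean_pos as Hmu; pose proof b_pos as Hb; pose proof var_pos as Hvar.
  assert (Hkap : 0 <= digit_square_mean).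
  { unfold digit_square_mean; apply Rmult_le_pos; [left; now apply Rinv_0_lt_compat|].
    apply (rsum_incr (fun j => INR (h j) ^ 2) 0 b); [intros; apply pow2_ge_0 | lia]. }
  set (eta := eps * mu / (2 * (digit_square_mean + 1))).
  assert (Heta : 0 < eta) by (apply Rdiv_lt_0_compat; nra).
  assert (Hke : digit_square_mean * eta <= mu * (eps / 2)).
  { replace (digit_square_mean * eta)
      with (mu * (eps / 2) * (digit_square_mean / (digit_square_mean + 1)))
      by (unfold eta; field; lra).
    rewrite <- (Rmult_1_r (mu * (eps / 2))) at 2.
    apply Rmult_le_compat_l; [nra|]; apply Rle_div_l; lra. }
  destruct (Pit_smooth eta Heta) as [J0 HJ0].
  (* [c] collects the Chebyshev, widening and rounding errors, all measured in units of [z ^ 5].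
     [X1] makes them small against [z ^ 6], [X2] gives [2 z^5 <= z^8 / b], and [X3] forces
     [J0 + N0 <= m0]. *)
  set (c := 4 * var / mu + 2 + 2 * mu).
  assert (Hvm : 0 < 4 * var / mu) by (apply Rdiv_lt_0_compat; lra).
  set (X1 := 2 * c / eps); set (X2 := 2 * INR b); set (X3 := mu * (INR J0 + INR N0 + 1)).
  assert (HX1 : 0 < X1) by (apply Rdiv_lt_0_compat; unfold c; lra).
  assert (HX2 : 0 < X2) by (unfold X2; lra).
  pose proof (pos_INR J0) as PJ; pose proof (pos_INR N0) as PN.
  assert (HX3 : mu <= X3) by (unfold X3; nra).
  destruct (nfloor_ex (16 * (X1 + X2 + X3))) as [n0 [_ Hn0]]; [lra|].
  exists (S n0); intros n lo hi Hnn Hn Hst.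
  pose proof (strict_bounds n lo hi Hn Hst) as (EL & Ehi & Hlo & Hhi).
  pose proof (proj1 Hst) as Hlh.
  pose proof (density_rsum lo hi Hlh) as Hd.
  pose proof (density_bounds lo hi Hlh) as Hd01.
  pose proof (root8_ge n) as Hzn.
  apply le_INR in Hnn; rewrite S_INR in Hnn.
  set (z := root8 n) in *; set (d := typeC_density b h C lo hi) in *.
  clearbody d z.
  assert (Hz : X1 + X2 + X3 + 1 <= z) by lra.
  (* Multiplying the upper bound on the number of steps by [d - eps / 2] needs a nonnegative
     factor. *)
  destruct (Rle_dec (d - eps / 2) 0) as [Hsmall|Hbig].
  { exists N0; split; [lia|].
    pose proof (Pit_bounds N0 TC (fun _ => ind_bounds _) 0); lra. }
  assert (Hz1 : 1 <= z) by lra.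
  assert (Z5 : z <= z ^ 5) by (rewrite <- (pow_1 z) at 1; apply Rle_pow; [lra | lia]).
  assert (Z58 : z ^ 5 <= z ^ 8) by (apply Rle_pow; [lra | lia]).
  assert (Zb : z ^ 5 + z ^ 5 <= z ^ 8 / INR b).
  { apply Rle_div_r; [lra|].
    replace (z ^ 8) with (z ^ 5 * z ^ 3) by ring.
    assert (z <= z ^ 3) by (rewrite <- (pow_1 z) at 1; apply Rle_pow; [lra | lia]).
    replace ((z ^ 5 + z ^ 5) * INR b) with (z ^ 5 * X2) by (unfold X2; ring).
    apply Rmult_le_compat_l; lra. }
  (* The margin [z ^ 5] lies between the walk's standard deviation, of order at most [z ^ 4], and
     the interval length [z ^ 6]. *)
  destruct (nfloor_ex ((INR lo - z ^ 5) / mu)) as [m0 [Hm0 Hm0']].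
  { apply Rlt_le, Rdiv_lt_0_compat; lra. }
  destruct (nfloor1_ex ((INR hi + 1 + z ^ 5) / mu)) as [M0 [HM0 HM0']].
  { apply Rdiv_lt_0_compat; pose proof (pos_INR hi); lra. }
  apply Rle_div_r in Hm0; [|lra]; apply Rlt_div_l in Hm0'; [|lra].
  apply Rlt_div_r in HM0; [|lra]; apply Rle_div_l in HM0'; [|lra].
  set (M := S M0).
  assert (EM : INR M = INR M0 + 1) by (unfold M; apply S_INR).
  assert (HmM : (m0 < M)%nat).
  { apply INR_lt; rewrite EM; apply Rmult_lt_reg_r with mu; [lra|].
    assert (0 < z ^ 6) by (apply pow_lt; lra). lra. }
  assert (Hm0N : (J0 + N0 <= m0)%nat).
  { apply Nat.lt_succ_r, INR_lt; rewrite S_INR, plus_INR.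
    apply Rmult_lt_reg_l with mu; [lra|]; unfold X3 in *; lra. }
  set (g := TC_on lo hi).
  set (K := rsum TC (S hi) - rsum TC lo) in *.
  assert (HK : 0 <= K) by (rewrite <- Hd, EL; apply Rmult_le_pos; [lra | apply pow_le; lra]).
  assert (Hw : 0 < z ^ 5) by lra.
  assert (Hw2 : 0 < (z ^ 5) ^ 2) by now apply pow_lt.
  assert (HMge : K * (1 - INR M * var / (z ^ 5) ^ 2) <= Pit M (rsum g) 0).
  { apply chebyshev_ge; [exact Hw|]; intros y.
    pose proof (rsum_TC_on_le lo hi y Hlh) as [G0 G1]; fold g in G0, G1; fold K in G1.
    apply quadratic_weight_ge; auto; intros Hx.
    unfold g; rewrite rsum_TC_on_high; [fold K; lra | exact Hlh |].
    apply INR_le; rewrite S_INR; rewrite EM in *; lra. }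
  assert (Hmle : Pit m0 (rsum g) 0 <= K * (INR m0 * var / (z ^ 5) ^ 2)).
  { apply chebyshev_le; [exact Hw|]; intros y.
    pose proof (rsum_TC_on_le lo hi y Hlh) as [G0 G1]; fold g in G0, G1; fold K in G1.
    apply quadratic_weight_le; auto; intros Hx.
    unfold g; rewrite rsum_TC_on_low; [lra|].
    apply Nat.lt_le_incl, INR_lt; lra. }
  assert (Hg : forall y, 0 <= g y <= 1).
  { intros y; pose proof (TC_on_bounds lo hi y); pose proof (ind_bounds (typeC b h C y)).
    unfold g; cbv beta in *; lra. }
  assert (Htel := Pit_rsum_telescope m0 g eta (M - m0) (Rlt_le _ _ Heta)
    (fun m Hm => HJ0 m g ltac:(lia) Hg)).
  replace (m0 + (M - m0))%nat with M in Htel by lia.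
  destruct (rsum_ge_exists (fun i => mu * Pit (m0 + i) g 0 + digit_square_mean * eta)
    (M - m0) (mu * (d - eps) + digit_square_mean * eta)) as (i & Hi & HV); [lia| |].
  - eapply Rle_trans; [|exact Htel].
    apply Rle_trans with
      (K * (1 - INR M * var / (z ^ 5) ^ 2) - K * (INR m0 * var / (z ^ 5) ^ 2)); [|lra].
    apply Rle_trans with (INR (M - m0) * (mu * (d - eps / 2))).
    { apply Rmult_le_compat_l; [apply pos_INR | lra]. }
    assert (HL : INR (M - m0) * mu <= z ^ 6 + 2 * z ^ 5 + 2 * mu).
    { rewrite minus_INR, EM by lia; lra. }
    assert (HP : (INR M + INR m0) * var / (z ^ 5) ^ 2 * z ^ 6 <= 4 * var / mu * z ^ 5).
    { assert (0 < z ^ 6) by (apply pow_lt; lra).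
      assert (A : (INR M + INR m0) * mu <= 4 * z ^ 8) by (rewrite EM; lra).
      replace ((INR M + INR m0) * var / (z ^ 5) ^ 2 * z ^ 6)
        with (var / mu * / z ^ 4 * ((INR M + INR m0) * mu)) by (field; split; lra).
      apply Rle_trans with (var / mu * / z ^ 4 * (4 * z ^ 8)).
      - apply Rmult_le_compat_l; [|exact A].
        apply Rmult_le_pos; [lra|]; left; apply Rinv_0_lt_compat, pow_lt; lra.
      - replace (var / mu * / z ^ 4 * (4 * z ^ 8)) with (4 * var / mu * z ^ 4) by (field; split; lra).
        apply Rmult_le_compat_l; [lra|]; apply Rle_pow; [lra | lia]. }
    assert (Hcz : c * z ^ 5 <= eps / 2 * z ^ 6).
    { replace (z ^ 6) with (z * z ^ 5) by ring; rewrite <- Rmult_assoc.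
      apply Rmult_le_compat_r; [lra|].
      replace c with (eps / 2 * X1) by (unfold X1; field; lra).
      apply Rmult_le_compat_l; lra. }
    assert (Z0 : 1 <= z ^ 5) by lra.
    rewrite <- Hd, EL.
    set (p := (INR M + INR m0) * var / (z ^ 5) ^ 2) in *.
    replace (d * z ^ 6 * (1 - INR M * var / (z ^ 5) ^ 2) - d * z ^ 6 * (INR m0 * var / (z ^ 5) ^ 2))
      with (d * z ^ 6 - d * (p * z ^ 6)) by (unfold p; field; lra).
    assert (Hp0 : 0 <= p * z ^ 6).
    { apply Rmult_le_pos; [|apply pow_le; lra].
      apply Rle_div_r; [lra|]; rewrite Rmult_0_l; apply Rmult_le_pos; [|lra].
      pose proof (pos_INR M); pose proof (pos_INR m0); lra. }
    apply Rle_trans with ((z ^ 6 + 2 * z ^ 5 + 2 * mu) * (d - eps / 2)).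
    { rewrite <- Rmult_assoc; apply Rmult_le_compat_r; lra. }
    assert (A1 : (2 * z ^ 5 + 2 * mu) * (d - eps / 2) <= (2 * z ^ 5 + 2 * mu) * 1)
      by (apply Rmult_le_compat_l; lra).
    assert (A2 : 2 * mu * 1 <= 2 * mu * z ^ 5) by (apply Rmult_le_compat_l; lra).
    assert (A3 : d * (p * z ^ 6) <= 1 * (p * z ^ 6)) by (apply Rmult_le_compat_r; lra).
    unfold c in Hcz; lra.
  - exists (m0 + i)%nat; split; [lia|].
    apply Rle_trans with (Pit (m0 + i) g 0).
    + apply Rmult_le_reg_l with mu; lra.
    + apply Pit_le; intros y; apply TC_on_bounds.
Qed.

(** The block starts at 0 but the ratio counts from 1; dropping the integer 0 costs at most one
    element. *)
Lemma ratio_pow_ge m : Pit m TC 0 - / INR (b ^ m) <= typeC_ratio b h C (b ^ m).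
Proof.
  assert (Hp : (0 < b ^ m)%nat) by (apply Nat.neq_0_lt_0, Nat.pow_nonzero; lia).
  pose proof (count_block_ge 0 m) as H; rewrite Hfun_0 in H; simpl (0 * _)%nat in H.
  rewrite Nat.add_0_l in H; simpl (rsum TC 0) in H.
  unfold typeC_ratio; destruct (b ^ m)%nat as [|N] eqn:E; [lia|].
  rewrite count_in_rsum by lia.
  assert (HN : 0 < INR (S N)) by (apply lt_0_INR; lia).
  apply Rle_div_r; [exact HN|].
  rewrite Rmult_minus_distr_r, Rinv_l by lra.
  assert (A := rsum_incr TC (S N) (S (S N)) TC_nonneg ltac:(lia)).
  assert (B : rsum TC 1 <= 1) by (simpl; pose proof (ind_bounds (typeC b h C 0)); lra).
  lra.
Qed.

Lemma LimSup_ratio_ge D :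
  (forall N, exists n lo hi, (N <= n)%nat /\ (0 < n)%nat /\ n_strict b n lo hi /\
     D <= typeC_density b h C lo hi) ->
  Rbar_le D (LimSup_seq (typeC_ratio b h C)).
Proof.
  intros H; apply LimSup_seq_ge; intros eps N He.
  destruct (nfloor_ex (2 / eps)) as [N1 [_ HN1]]; [apply Rlt_le, Rdiv_lt_0_compat; lra|].
  destruct (Pit_mass_ge (eps / 2) (N + S N1) ltac:(lra)) as [n0 Hn0].
  destruct (H n0) as (n & lo & hi & A1 & A2 & A3 & A4).
  destruct (Hn0 n lo hi A1 A2 A3) as (m & Hm & Hd).
  (* This makes [b ^ m] exceed both [N] and [2 / eps], so dropping 0 costs at most the other half of
     [eps]. *)
  assert (Hpow : (m < b ^ m)%nat) by (apply Nat.pow_gt_lin_r; lia).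
  exists (b ^ m)%nat; split; [lia|].
  eapply Rle_trans; [|apply ratio_pow_ge].
  assert (Hi : / INR (b ^ m) <= eps / 2); [|lra].
  assert (INR (S N1) <= INR (b ^ m)) by (apply le_INR; lia).
  rewrite S_INR in *.
  replace (eps / 2) with (/ (2 / eps)) by (field; lra).
  apply Rinv_le_contravar; [apply Rdiv_lt_0_compat; lra | lra].
Qed.

End Digits.

Theorem theorem4p1 (b : nat) (h : nat -> nat) (C : nat -> Prop)
  (n1 lo hi : nat) (d1 : R) :
  (1 < b)%nat -> h 0%nat = 0%nat -> h 1%nat = 1%nat ->
  (0 < n1)%nat ->
  (* (B1) *)
  4 * (1 + 3 * digit_mean b h
         + sqrt 2 * digit_sd b h * Rpower (INR b) (5 * INR n1 / 8))
    <= INR b ^ (n1 - 1) ->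
  (* (B2) *)
  sqrt (3 * digit_mean b h * INR b) * digit_sd b h
    <= Rpower (INR b) (3 * INR n1 / 8) ->
  (* (B3) *)
  4 * digit_mean b h *
    (3 * digit_mean b h + 1 + Rpower (INR b) (3 * INR n1 / 4)
     + 2 * digit_sd b h * / sqrt (digit_mean b h) * Rpower (INR b) (5 * INR n1 / 8))
    <= INR b ^ (n1 - 1) ->
  n_strict b n1 lo hi ->
  typeC_density b h C lo hi = d1 ->
  Rbar_le
    (Finite (d1 * exp (- (2 / (Rpower (INR b) (INR n1 / 4) - 1))
                       - 4 * digit_sd b h /
                         (sqrt (digit_mean b h) * (Rpower (INR b) (INR n1 / 8) - 1)))))
    (LimSup_seq (typeC_ratio b h C)).
Proof.
  intros hb h0 h1 Hn B1 _ B3 Hst <-.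
  assert (E2 : Rpower (INR b) (INR n1 / 4) = root8 b n1 ^ 2)
    by (rewrite root8_pow; f_equal; simpl; field).
  assert (E5 : Rpower (INR b) (5 * INR n1 / 8) = root8 b n1 ^ 5)
    by (rewrite root8_pow; f_equal; simpl; field).
  assert (E6 : Rpower (INR b) (3 * INR n1 / 4) = root8 b n1 ^ 6)
    by (rewrite root8_pow; f_equal; simpl; field).
  rewrite E5, (root8_pred b hb n1 Hn) in B1.
  rewrite E5, E6, (root8_pred b hb n1 Hn) in B3.
  assert (HB : bound_B b h (root8 b n1)) by (split; assumption).
  assert (Hz : 2 <= root8 b n1)
    by (apply (bound_B_ge2 b hb h h0 h1); [apply exp_pos | exact HB]).
  assert (Hr := sqrt_mean_pos b hb h h0 h1).
  apply (LimSup_ratio_ge b hb h h0 h1); intros N.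
  destruct (strict_intervals_unbounded b hb h h0 h1 C n1 lo hi Hn HB Hst N)
    as (n & lo' & hi' & A1 & A2 & A3 & A4).
  exists n, lo', hi'; repeat split; try assumption; try apply A3.
  eapply Rle_trans; [right | exact A4].
  f_equal; f_equal; rewrite E2; change (Rpower (INR b) (INR n1 / 8)) with (root8 b n1).
  unfold potential; field; repeat split; nra.
Qed.
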